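(* Let $t\in\mathbb R\setminus\{0\}$, let $\alpha_1,\dots,\alpha_N\in\mathbb H_t$ satisfy $\|\alpha_j\|_{op}<1$, $j=1,\dots,N$, and let $\mathbf G_{\circledast}\in\mathbb H_t^{N\times N}$ be the matrix with $(j,k)$ entry $\sum_{n=0}^\infty\alpha_j^n\alpha_k^{\circledast n}$. Assume $\mathbf G_{\circledast}$ is invertible in $\mathbb H_t^{N\times N}$ and define $$\Theta(q_t)=1-(1-q_t)\star\begin{pmatrix}(1-q_t\alpha_1^{\circledast})^{-\star}&\cdots&(1-q_t\alpha_N^{\circledast})^{-\star}\end{pmatrix}\mathbf G_{\circledast}^{-1}\begin{pmatrix}(1-\alpha_1)^{-1}\\ \vdots\\ (1-\alpha_N)^{-1}\end{pmatrix}.$$ Then a function $f\in\mathbf H_{2,\circledast}^t$ vanishes at $\alpha_1,\dots,\alpha_N$ if it can be written as $f=\Theta\star g$ with $g\in\mathbf H_{2,\circledast}^t$, and, moreover, in this case $$[f,f]_{\circledast}=[g,g]_{\circledast}.$$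
   Context: For $t\in\mathbb R\setminus\{0\}$, $\mathbb H_t$ is the real algebra (matrix addition and multiplication) of matrices $q_t=\begin{pmatrix}a&tb\\ \overline b&\overline a\end{pmatrix}$, $a,b\in\mathbb C$, with unit $1=I_2$; $q_t^{\circledast}=\begin{pmatrix}\overline a&-tb\\ -\overline b&a\end{pmatrix}$, $\alpha^{\circledast n}=(\alpha^{\circledast})^n$; $\|q_t\|_{op}$ is the operator norm of the matrix on $\mathbb C^2$ and $\|q_t\|_E=\sqrt{|a|^2+|t||b|^2}$. $\mathbf H_2^t$ is the real vector space of power series $f(q_t)=\sum_{n=0}^\infty q_t^n\alpha_n$, $\alpha_n\in\mathbb H_t$, with $\sum_n\|\alpha_n\|_E^2<\infty$; such a series converges for $\|q_t\|_{op}<1$, and $f$ vanishes at $\alpha$ if $f(\alpha)=\sum_n\alpha^n\alpha_n=0$. $\mathbf H_{2,\circledast}^t$ is $\mathbf H_2^t$ endowed with the real symmetric form $[f,g]_\circledast=\sum_{n=0}^\infty{\rm Tr}\,(g_n^{\circledast}f_n)$ for $f=\sum q_t^nf_n$, $g=\sum q_t^ng_n$. The $\star$-product of power series (also with matrix coefficients of compatible sizes over $\mathbb H_t$) is $\left(\sum q_t^n\alpha_n\right)\star\left(\sum q_t^n\beta_n\right)=\sum_n q_t^n\sum_{k=0}^n\alpha_{n-k}\beta_k$, and $S^{-\star}$ is the inverse of $S$ for $\star$; thus $(1-q_t\alpha^{\circledast})^{-\star}=\sum_n q_t^n\alpha^{\circledast n}$. *)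

(* Defs.v *)
From HB Require Import structures.
From mathcomp Require Import all_boot all_order all_algebra.
From mathcomp Require Import complex ring.
From mathcomp Require Import all_classical all_reals all_analysis.

Set Implicit Arguments.
Unset Strict Implicit.
Unset Printing Implicit Defensive.

Import Order.TTheory GRing.Theory Num.Theory.
Import numFieldNormedType.Exports.

Local Open Scope classical_set_scope.
Local Open Scope ring_scope.
Local Open Scope complex_scope.

Section HtMatrices.
Variables (R : realType) (t : R).

Definition hmx (a b : R[i]) : 'M[R[i]]_2 :=
  \matrix_(i < 2, j < 2)
    if i == 0 then (if j == 0 then a else t%:C * b)
    else (if j == 0 then b^*%C else a^*%C).

Definition Hpred : {pred 'M[R[i]]_2} := fun M => `[< exists a b, M = hmx a b >].

Lemma HpredP M : reflect (exists a b, M = hmx a b) (M \in Hpred).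
Proof. exact: asboolP. Qed.

Lemma hmx_in a b : hmx a b \in Hpred.
Proof. by apply/HpredP; exists a, b. Qed.

Lemma mx2P (A B : 'M[R[i]]_2) :
  A 0 0 = B 0 0 -> A 0 1 = B 0 1 -> A 1 0 = B 1 0 -> A 1 1 = B 1 1 -> A = B.
Proof.
move=> h00 h01 h10 h11; apply/matrixP => i j.
have I2 (k : 'I_2) : k = 0 \/ k = 1.
  by case: k => [[|[|//]]] h; [left|right]; apply: val_inj.
by case: (I2 i) => ->; case: (I2 j) => ->.
Qed.

Lemma mulmx2E (A B : 'M[R[i]]_2) i j :
  (A * B) i j = A i 0 * B 0 j + A i 1 * B 1 j.
Proof.
rewrite mxE big_ord_recl big_ord1; congr (_ + A i _ * B _ j); exact: val_inj.
Qed.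

Lemma hmx00 a b : hmx a b 0 0 = a. Proof. by rewrite mxE. Qed.
Lemma hmx01 a b : hmx a b 0 1 = t%:C * b. Proof. by rewrite mxE. Qed.
Lemma hmx10 a b : hmx a b 1 0 = b^*%C. Proof. by rewrite mxE. Qed.
Lemma hmx11 a b : hmx a b 1 1 = a^*%C. Proof. by rewrite mxE. Qed.
Definition hmxE := (hmx00, hmx01, hmx10, hmx11).

Lemma hmx1 : hmx 1 0 = 1.
Proof.
by apply: mx2P; rewrite hmxE ?mulr0 ?conjc0 ?conjc1 mxE.
Qed.

Lemma conjcD (x y : R[i]) : (x + y)^*%C = x^*%C + y^*%C.
Proof. exact: rmorphD. Qed.

Lemma conjcM (x y : R[i]) : (x * y)^*%C = x^*%C * y^*%C.
Proof. exact: rmorphM. Qed.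

Lemma conjcN (x : R[i]) : (- x)^*%C = - x^*%C.
Proof. exact: rmorphN. Qed.

Lemma hmxB a b c d : hmx a b - hmx c d = hmx (a - c) (b - d).
Proof.
by apply: mx2P; rewrite !hmxE mxE [X in _ + X]mxE !hmxE ?mulrBr ?rmorphB.
Qed.

Lemma hmxM a b c d :
  hmx a b * hmx c d = hmx (a * c + t%:C * (b * d^*%C)) (a * d + b * c^*%C).
Proof.
by apply: mx2P; rewrite mulmx2E !hmxE ?(conjcD, conjcM, conjc_real, conjcK);
  ring.
Qed.

Definition hdet (a b : R[i]) : R[i] := a * a^*%C - t%:C * (b * b^*%C).

Lemma hmx_adj a b : hmx a b * hmx a^*%C (- b) = hmx (hdet a b) 0.
Proof.
by rewrite hmxM /hdet !conjcN !conjcK; congr hmx; ring.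
Qed.

Lemma hmxV a b : hmx a b \is a GRing.unit ->
  (hmx a b)^-1 = hmx (a^*%C / hdet a b) (- b / hdet a b).
Proof.
move=> uM; apply: (mulrI uM); rewrite divrr // -hmx1 hmxM.
have d0 : hdet a b != 0.
  apply/eqP => d0; have := hmx_adj a b.
  have h00 : hmx 0 0 = 0 by rewrite -(subrr (hmx 1 0)) hmxB !subrr.
  rewrite d0 h00 => /(canRL (mulKr uM)); rewrite mulr0 => /matrixP e.
  have := e 0 0; have := e 1 0; rewrite !hmxE !mxE conjcN.
  move=> /eqP; rewrite oppr_eq0 conjc_eq0 => /eqP b0 /eqP.
  rewrite conjc_eq0 => /eqP a0; move: uM.
  by rewrite a0 b0 h00 unitr0.
have dr : (hdet a b)^*%C = hdet a b.
  by rewrite /hdet conjcD conjcN !conjcM conjc_real !conjcK; ring.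
rewrite !conjcM !conjc_inv conjcN conjcK dr; congr hmx; last by ring.
have -> : a * (a^*%C / hdet a b) + t%:C * (b * (- b^*%C / hdet a b))
    = hdet a b / hdet a b.
  by rewrite {3}/hdet; move: (hdet a b)^-1 => d; ring.
by rewrite divff.
Qed.

Lemma Hpred_divring : divring_closed Hpred.
Proof.
split=> [|x y|x y].
- by rewrite -hmx1 hmx_in.
- by case/HpredP=> [a [b ->]] /HpredP [c [d ->]]; rewrite hmxB hmx_in.
move=> /HpredP [a [b ->]] /HpredP [c [d ->]].
have [u|nu] := boolP (hmx c d \is a GRing.unit); last first.
  by rewrite invr_out // hmxM hmx_in.
by rewrite hmxV // hmxM hmx_in.
Qed.

HB.instance Definition _ :=
  GRing.isDivringClosed.Build 'M[R[i]]_2 Hpred Hpred_divring.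

Record Ht := HMat { hval : 'M[R[i]]_2; hvalP : hval \in Hpred }.

HB.instance Definition _ := [isSub for hval].
HB.instance Definition _ := [Choice of Ht by <:].
HB.instance Definition _ := [SubChoice_isSubUnitRing of Ht by <:].

(* The topology induced by that of the 2 x 2 complex matrices. *)
HB.instance Definition _ := isPointed.Build Ht 0.
HB.instance Definition _ :=
  Uniform.copy Ht (initial_topology (hval : Ht -> 'M[R[i]^o]_2)).

End HtMatrices.
Section PowerSeries.
Variable A : nzRingType.

(* Formal power series sum_n q^n (f n); the variable q is central and the ring
   product is the star-product.  A wrapper is needed since nat -> A already
   carries the pointwise product. *)
Record pser := PSer { pcoef :> nat -> A }.

HB.instance Definition _ := [isNew for pcoef].
HB.instance Definition _ := gen_eqMixin pser.
HB.instance Definition _ := gen_choiceMixin pser.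

Implicit Types f g h : pser.

Lemma pserP f g : (forall n, f n = g n) -> f = g.
Proof. by case: f g => [f] [g] /= e; congr PSer; apply/funext. Qed.

Definition padd f g := PSer (fun n => f n + g n).
Definition popp f := PSer (fun n => - f n).
Definition pzero := PSer (fun=> 0).
Definition pstar f g := PSer (fun n => \sum_(k < n.+1) f (n - k)%N * g k).
Definition pC (c : A) := PSer (fun n => if n == 0%N then c else 0).
Definition pX := PSer (fun n => (n == 1%N)%:R).

Lemma paddA : associative padd.
Proof. by move=> f g h; apply: pserP => n; rewrite /= addrA. Qed.
Lemma paddC : commutative padd.
Proof. by move=> f g; apply: pserP => n; rewrite /= addrC. Qed.
Lemma padd0 : left_id pzero padd.
Proof. by move=> f; apply: pserP => n; rewrite /= add0r. Qed.
Lemma paddN : left_inverse pzero popp padd.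
Proof. by move=> f; apply: pserP => n; rewrite /= addNr. Qed.

HB.instance Definition _ := GRing.isZmodule.Build pser paddA paddC padd0 paddN.

Definition ptrunc m f : {poly A} := \poly_(i < m) f i.

Lemma pstar_poly m f g n : (n < m)%N -> pstar f g n = (ptrunc m f * ptrunc m g)`_n.
Proof.
move=> nm; rewrite coefMr; apply: eq_bigr => k _.
rewrite !coef_poly (leq_ltn_trans (leq_subr _ _) nm).
by rewrite (leq_trans (ltn_ord k)).
Qed.

Lemma ptrunc_star m f g n : (n < m)%N ->
  (ptrunc m (pstar f g))`_n = (ptrunc m f * ptrunc m g)`_n.
Proof. by move=> nm; rewrite coef_poly nm (pstar_poly _ _ nm). Qed.

Lemma pstarA : associative pstar.
Proof.
move=> f g h; apply: pserP => n; rewrite !(@pstar_poly n.+1) //.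
transitivity ((ptrunc n.+1 f * (ptrunc n.+1 g * ptrunc n.+1 h))`_n).
  by rewrite !coefM; apply: eq_bigr => k _; rewrite ptrunc_star // ltnS leq_subr.
by rewrite mulrA !coefM; apply: eq_bigr => k _; rewrite ptrunc_star.
Qed.

Lemma pCstar c f n : pstar (pC c) f n = c * f n.
Proof.
rewrite /= big_ord_recr /= subnn big1 ?add0r // => k _.
by rewrite subn_eq0 leqNgt ltn_ord mul0r.
Qed.

Lemma pstarC c f n : pstar f (pC c) n = f n * c.
Proof.
by rewrite /= big_ord_recl /= subn0 big1 ?addr0 // => k _; rewrite mulr0.
Qed.

Lemma p1star : left_id (pC 1) pstar.
Proof. by move=> f; apply: pserP => n; rewrite pCstar mul1r. Qed.
Lemma pstar1 : right_id (pC 1) pstar.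
Proof. by move=> f; apply: pserP => n; rewrite pstarC mulr1. Qed.
Lemma pstarDl : left_distributive pstar +%R.
Proof.
move=> f g h; apply: pserP => n; rewrite /= -big_split.
by apply: eq_bigr => k _; rewrite /= mulrDl.
Qed.
Lemma pstarDr : right_distributive pstar +%R.
Proof.
move=> f g h; apply: pserP => n; rewrite /= -big_split.
by apply: eq_bigr => k _; rewrite /= mulrDr.
Qed.
Lemma p1_neq0 : pC 1 != 0.
Proof.
apply/eqP => /(congr1 (fun f : pser => f 0%N)) /= /eqP.
by rewrite oner_eq0.
Qed.

HB.instance Definition _ := GRing.Zmodule_isNzRing.Build pser
  pstarA p1star pstar1 pstarDl pstarDr p1_neq0.

Definition pinv_of f : set pser := [set g | g * f = 1 /\ f * g = 1].
Definition punit : pred pser := fun f => `[< exists g, pinv_of f g >].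
(* The two-sided inverse for the star-product, when it exists. *)
Definition pinv f : pser := xget f (pinv_of f).

Lemma pinvP f : f \in punit -> pinv_of f (pinv f).
Proof. by move=> /asboolP [g hg]; exact: xgetPex (ex_intro _ g hg). Qed.

Lemma pmulVr : {in punit, left_inverse 1 pinv *%R}.
Proof. by move=> f /pinvP []. Qed.
Lemma pdivrr : {in punit, right_inverse 1 pinv *%R}.
Proof. by move=> f /pinvP []. Qed.
Lemma punitP f g : g * f = 1 /\ f * g = 1 -> punit f.
Proof. by move=> hg; apply/asboolP; exists g. Qed.
Lemma pinv_out : {in [predC punit], pinv =1 id}.
Proof.
move=> f /asboolPn nf; apply: xgetPN => g hg; apply: nf.
by exists g.
Qed.

HB.instance Definition _ :=
  GRing.NzRing_hasMulInverse.Build pser pmulVr pdivrr punitP pinv_out.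

Lemma psubE f g n : (f - g) n = f n - g n. Proof. by []. Qed.
Lemma p1E n : (1 : pser) n = (n == 0%N)%:R. Proof. by case: n. Qed.
Lemma pmulE f g n : (f * g) n = \sum_(k < n.+1) f (n - k)%N * g k.
Proof. by []. Qed.

Lemma pXstar f n : (pX * f) n = if n is m.+1 then f m else 0.
Proof.
case: n => [|n]; first by rewrite pmulE big_ord_recl big_ord0 mul0r addr0.
rewrite pmulE !big_ord_recr /= subnn mul0r addr0 subSnn mul1r.
rewrite big1 ?add0r // => k _.
suff -> : (n.+1 - k == 1)%N = false by rewrite mul0r.
by rewrite subSn ?eqSS ?subn_eq0 ?(ltnW (ltn_ord k)) // leqNgt ltn_ord.
Qed.

Lemma pC1_subE c : 1 - pX * pC c = PSer (fun n => 
  if n == 0%N then 1 else if n == 1%N then - c else 0).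
Proof.
apply: pserP => n; rewrite psubE pXstar ?p1E.
by case: n => [|[|n]] //=; rewrite ?subr0 ?sub0r ?oppr0.
Qed.

Lemma pgeom c : (1 - pX * pC c)^-1 = PSer (fun n => c ^+ n).
Proof.
set g := PSer _.
have l : (1 - pX * pC c) * g = 1.
  rewrite mulrBl mul1r -mulrA; apply: pserP => n.
  rewrite psubE pXstar ?p1E.
  case: n => [|n]; first by rewrite subr0 /= expr0.
  have -> : (pC c * g) n = c * g n by exact: pCstar.
  by rewrite /= exprS subrr.
have r : g * (1 - pX * pC c) = 1.
  apply: pserP => n; rewrite pC1_subE pmulE p1E.
  case: n => [|n] /=; first by rewrite big_ord_recl big_ord0 addr0 mulr1.
  rewrite big_ord_recl big_ord_recl big1 => [|k _]; last by rewrite mulr0.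
  by rewrite /= addr0 subn0 subSS subn0 mulr1 mulrN -exprSr subrr.
have u : 1 - pX * pC c \is a GRing.unit by apply/unitrP; exists g.
by apply: (mulrI u); rewrite divrr.
Qed.

End PowerSeries.

Section Space.
Variables (R : realType) (t : R).
Local Notation H := (Ht t).

Definition ha (q : H) : R[i] := hval q 0 0.
Definition hb (q : H) : R[i] := (hval q 1 0)^*%C.

Lemma hvalE q : hval q = hmx t (ha q) (hb q).
Proof.
have /HpredP [a [b e]] := hvalP q.
by rewrite /ha /hb e !hmxE conjcK.
Qed.

(* The circled-star involution: the matrix [[a^*, - t b], [- b^*, a]]. *)
Definition hadj (q : H) : H := HMat (hmx_in t (ha q)^*%C (- hb q)).

Definition vnorm (v : 'cV[R[i]]_2) : R :=
  Num.sqrt (\sum_(i < 2) Normc.normc (v i 0) ^+ 2).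

Definition norm_op (q : H) : R :=
  sup [set vnorm (hval q *m v) | v in [set v | vnorm v <= 1]].

Definition norm_E (q : H) : R :=
  Num.sqrt (Normc.normc (ha q) ^+ 2 + `|t| * Normc.normc (hb q) ^+ 2).

(* Taking the real part loses nothing: see htrE. *)
Definition htr (q : H) : R := complex.Re (\tr (hval q)).

Lemma htrE q : (htr q)%:C = \tr (hval q).
Proof.
rewrite /htr hvalE /mxtrace big_ord_recl big_ord1.
have -> : lift ord0 ord0 = 1 :> 'I_2 by exact: val_inj.
by rewrite !hmxE; case: (ha q) => x y; apply/eqP; rewrite eq_complex /= subrr !eqxx.
Qed.

(* The space H_2^t, each power series being given by its coefficients. *)
Definition H2 : set (pser H) :=
  [set f | cvgn (series (fun n => norm_E (f n) ^+ 2))].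

Definition hform (f g : pser H) : R :=
  limn (series (fun n => htr (hadj (g n) * f n))).

(* The series sum_n q^n f_n converges, with sum 0. *)
Definition vanishes_at (f : pser H) (q : H) : Prop :=
  series (fun n => q ^+ n * f n) @ \oo --> (0 : H).

Definition gram N (a : 'I_N -> H) : 'M[H]_N :=
  \matrix_(j, k) limn (series (fun n => a j ^+ n * hadj (a k) ^+ n)).

(* Ginv stands for the inverse of gram a. *)
Definition Theta N (a : 'I_N -> H) (Ginv : 'M[H]_N) : pser H :=
  1 - (1 - pX H) *
    ((\row_j (1 - pX H * pC (hadj (a j)))^-1) *m
     map_mx (@pC H) Ginv *m
     (\col_j pC (1 - a j)^-1)) 0 0.

End Space.

(* Main.v *)
From HB Require Import structures.
Require Import Defs.
From mathcomp Require Import all_boot all_order all_algebra.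
From mathcomp Require Import complex ring lra.
From mathcomp Require Import all_classical all_reals all_analysis.
Set Implicit Arguments.
Unset Strict Implicit.
Unset Printing Implicit Defensive.
Import Order.TTheory GRing.Theory Num.Theory.
Import numFieldNormedType.Exports.
Local Open Scope classical_set_scope.
Local Open Scope ring_scope.

(* Write [c_j] for the circled-star adjoint of [alpha_j].  The multiplication
   by [Theta] is realized by a linear system: with
   [b = G^-1 ((1 - alpha_k)^-1)_k] and [z_j (n+1) = c_j z_j(n) + b_j g_n],
   one has [f_n = g_n + \sum_j (z_j(n) - z_j(n+1))].  Let
   [x_j = (1 - c_j) z_j] and [P = G x].  The Stein equation
   [G_jk - alpha_j G_jk c_k = 1] yields [alpha_j P_j(n+1) = P_j(n) - f_n], so
   the partial sums of [f(alpha_j)] telescope to [- alpha_j^n P_j(n)].  It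
   also yields the energy balance: the [x]-energy [\sum_j x_j^* P_j] grows by
   [g_n^* g_n - f_n^* f_n] at each step.  Both conclusions follow since the
   state tends to [0], the powers of [c_j] decaying geometrically and [g_n]
   tending to [0]. *)

(** * Algebra of the involution and of the trace on [Ht t] *)

Section Ht_algebra.
Context {R : realType} {t : R}.
Implicit Types x y q : Ht t.

Lemma ord2P (i : 'I_2) : i = 0 \/ i = 1.
Proof. by case: i => [[|[|//]]] h; [left|right]; apply: val_inj. Qed.

Lemma sum2E (V : nmodType) (F : 'I_2 -> V) : \sum_i F i = F 0 + F 1.
Proof. by rewrite big_ord_recl big_ord1; congr (_ + F _); apply: val_inj. Qed.

Lemma hval_inj : injective (@hval R t). Proof. exact: val_inj. Qed.

Lemma hvalB x y : hval (x - y) = hval x - hval y. Proof. by []. Qed.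
Lemma hvalD x y : hval (x + y) = hval x + hval y. Proof. by []. Qed.
Lemma hvalM x y : hval (x * y) = hval x * hval y. Proof. by []. Qed.
Lemma hval0 : hval (0 : Ht t) = 0. Proof. by []. Qed.
Lemma hval1 : hval (1 : Ht t) = 1. Proof. by []. Qed.

(** Entrywise, [hadj] is the adjugate of a 2 x 2 matrix and the conjugations disappear. Additivity,
    antimultiplicativity and involutivity thus become polynomial identities in the entries. *)
Lemma hadj_entries q :
  [/\ hval (hadj q) 0 0 = hval q 1 1, hval (hadj q) 0 1 = - hval q 0 1,
      hval (hadj q) 1 0 = - hval q 1 0 & hval (hadj q) 1 1 = hval q 0 0].
Proof.
have e := hvalE q; rewrite /hadj [hval (HMat _)]/(hmx _ _ _) e.
rewrite !hmxE conjcN conjcK mulrN; by split; rewrite ?conjcK.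
Qed.

Lemma hadjD : {morph @hadj R t : x y / x + y}.
Proof.
move=> x y; apply: hval_inj; rewrite hvalD.
have [a b c d] := hadj_entries x; have [a' b' c' d'] := hadj_entries y.
have [a2 b2 c2 d2] := hadj_entries (x + y).
by apply: mx2P; rewrite ?a2 ?b2 ?c2 ?d2 [RHS]mxE ?a ?b ?c ?d ?a' ?b' ?c' ?d'
  hvalD mxE ?opprD.
Qed.

Lemma hadjM x y : hadj (x * y) = hadj y * hadj x.
Proof.
apply: hval_inj; rewrite hvalM.
have [a b c d] := hadj_entries x; have [a' b' c' d'] := hadj_entries y.
have [a2 b2 c2 d2] := hadj_entries (x * y).
by apply: mx2P; rewrite ?a2 ?b2 ?c2 ?d2 [RHS]mulmx2E ?a ?b ?c ?d ?a' ?b' ?c' ?d'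
  hvalM mulmx2E; ring.
Qed.

Lemma hadj0 : hadj (0 : Ht t) = 0.
Proof. by apply: (addrI (hadj 0)); rewrite -hadjD !addr0. Qed.

Lemma hadjN : {morph @hadj R t : x / - x}.
Proof. by move=> x; apply: (addrI (hadj x)); rewrite -hadjD !subrr hadj0. Qed.

(** Besides giving access to [raddf_sum], this makes [hadj] eligible as the additive map [star] of
    the abstract system studied below. *)
HB.instance Definition _ := GRing.isZmodMorphism.Build (Ht t) (Ht t) (@hadj R t)
  (fun x y => etrans (hadjD x (- y)) (congr1 _ (hadjN y))).

Lemma hadj1 : hadj (1 : Ht t) = 1.
Proof.
apply: hval_inj; rewrite hval1; have [a b c d] := hadj_entries 1.
by apply: mx2P; rewrite ?a ?b ?c ?d hval1 !mxE ?oppr0.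
Qed.

Lemma hadjK : involutive (@hadj R t).
Proof.
move=> x; apply: hval_inj.
have [a b c d] := hadj_entries x; have [a' b' c' d'] := hadj_entries (hadj x).
by apply: mx2P; rewrite ?a' ?b' ?c' ?d' ?a ?b ?c ?d ?opprK.
Qed.

Lemma hadjX q n : hadj (q ^+ n) = hadj q ^+ n.
Proof.
by elim: n => [|n IH]; rewrite ?expr0 ?hadj1 // exprS hadjM IH exprSr.
Qed.

Lemma htrD x y : htr (x + y) = htr x + htr y.
Proof. by rewrite /htr hvalD !raddfD. Qed.

Lemma htr0 : htr (0 : Ht t) = 0.
Proof. by rewrite /htr hval0 !raddf0. Qed.

End Ht_algebra.

(** * A submultiplicative norm on [Ht t] *)

Local Notation normc := Normc.normc.

Section Ht_norm.
Context {R : realType} {t : R}.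
Implicit Types x y q : Ht t.

(** This working norm is submultiplicative, invariant under [hadj] and compatible with the topology;
    [norm_op] and [norm_E] are compared with it once each. *)
Definition ht_norm q : R := \sum_(i < 2) \sum_(j < 2) normc (hval q i j).

Lemma normc_ge0 (z : R[i]) : 0 <= normc z.
Proof. by case: z => a b; rewrite /= sqrtr_ge0. Qed.

Lemma normc_conj (z : R[i]) : normc z^*%C = normc z.
Proof. by case: z => a b; rewrite /= sqrrN. Qed.

Lemma normc_real (x : R) : normc x%:C%C = `|x|.
Proof. by rewrite /= expr0n addr0 sqrtr_sqr. Qed.

Lemma normc_bool (b : bool) : normc (b%:R : R[i]) = b%:R.
Proof. by case: b; [exact: Normc.normc1|exact: Normc.normc0]. Qed.

Lemma ht_normE q : ht_norm q =
  normc (hval q 0 0) + normc (hval q 0 1) +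
  (normc (hval q 1 0) + normc (hval q 1 1)).
Proof. by rewrite /ht_norm !sum2E. Qed.

Lemma ht_norm_ge0 q : 0 <= ht_norm q.
Proof. by apply: sumr_ge0 => i _; apply: sumr_ge0 => j _; exact: normc_ge0. Qed.

Lemma ht_norm0 : ht_norm 0 = 0.
Proof. by rewrite ht_normE hval0 !mxE Normc.normc0 !addr0. Qed.

Lemma ht_normD x y : ht_norm (x + y) <= ht_norm x + ht_norm y.
Proof.
rewrite /ht_norm -big_split; apply: ler_sum => i _.
rewrite -big_split; apply: ler_sum => j _.
by rewrite hvalD mxE; exact: le_normcD.
Qed.

Lemma ht_normN q : ht_norm (- q) = ht_norm q.
Proof.
rewrite -sub0r; apply: eq_bigr => i _; apply: eq_bigr => j _.
by rewrite hvalB hval0 sub0r mxE normcN.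
Qed.

Lemma ht_norm_sum (I : Type) (s : seq I) (P : pred I) (F : I -> Ht t) :
  ht_norm (\sum_(i <- s | P i) F i) <= \sum_(i <- s | P i) ht_norm (F i).
Proof.
apply: (big_ind2 (fun x r => ht_norm x <= r)) => //; first by rewrite ht_norm0.
by move=> x1 x2 y1 y2 h1 h2; rewrite (le_trans (ht_normD _ _)) // lerD.
Qed.

Lemma ht_normM x y : ht_norm (x * y) <= ht_norm x * ht_norm y.
Proof.
rewrite !ht_normE hvalM !mulmx2E.
set a := hval x; set b := hval y.
have h (i j : 'I_2) : normc (a i 0 * b 0 j + a i 1 * b 1 j) <=
    normc (a i 0) * normc (b 0 j) + normc (a i 1) * normc (b 1 j).
  by rewrite (le_trans (le_normcD _ _)) // !Normc.normcM.
have p (i j k l : 'I_2) : 0 <= normc (a i j) * normc (b k l).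
  by rewrite mulr_ge0 // normc_ge0.
move: (h 0 0) (h 0 1) (h 1 0) (h 1 1).
(* These eight products have mismatched inner indices: they occur only in the expanded right-hand
   side, so their nonnegativity suffices. *)
move: (p 0 0 1 0) (p 0 0 1 1) (p 0 1 0 0) (p 0 1 0 1).
move: (p 1 0 1 0) (p 1 0 1 1) (p 1 1 0 0) (p 1 1 0 1).
rewrite !(mulrDl, mulrDr).
move: (normc (_ + _)) (normc (_ + _)) (normc (_ + _)) (normc (_ + _)).
move=> *; lra.
Qed.

Lemma ht_norm_hadj q : ht_norm (hadj q) = ht_norm q.
Proof.
by rewrite !ht_normE; have [-> -> -> ->] := hadj_entries q; rewrite !normcN; ring.
Qed.

Lemma ht_norm_eq0 q : ht_norm q = 0 -> q = 0.
Proof.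
move=> /eqP; rewrite psumr_eq0 => [/allP h|i _]; last first.
  by apply: sumr_ge0 => j _; exact: normc_ge0.
apply: hval_inj; apply/matrixP => i j; rewrite hval0 mxE.
have := h i; rewrite mem_index_enum => /(_ isT) /=.
rewrite psumr_eq0 => [/allP/(_ j)|k _]; last exact: normc_ge0.
by rewrite mem_index_enum => /(_ isT) /eqP /Normc.eq0_normc.
Qed.

Lemma normc_le_ht_norm q i j : normc (hval q i j) <= ht_norm q.
Proof.
rewrite /ht_norm (bigD1 i) //= (bigD1 j) //= -addrA lerDl addr_ge0 //.
  by apply: sumr_ge0 => k _; exact: normc_ge0.
by apply: sumr_ge0 => l _; apply: sumr_ge0 => k _; exact: normc_ge0.
Qed.

Lemma normr_Re_le (z : R[i]) : `|complex.Re z| <= normc z.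
Proof.
by case: z => a b; rewrite /= -sqrtr_sqr ler_wsqrtr // lerDl sqr_ge0.
Qed.

Lemma htr_le_ht_norm q : `|htr q| <= ht_norm q.
Proof.
rewrite /htr /mxtrace sum2E raddfD (le_trans (ler_normD _ _)) //=.
have := normr_Re_le (hval q 0 0); have := normr_Re_le (hval q 1 1).
have := normc_ge0 (hval q 0 1); have := normc_ge0 (hval q 1 0).
rewrite ht_normE => *; lra.
Qed.

End Ht_norm.

(** * Topology of [Ht t] through [ht_norm], and completeness *)

Lemma cvgr0_seqP (R : realType) (f : R^nat) :
  (f @ \oo --> (0 : R)) <->
  (forall e, 0 < e -> \forall n \near \oo, `|f n| < e).
Proof. exact: (@cvgr0Pnorm_lt R R). Qed.

Section Ht_topology.
Context {R : realType} {t : R}.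
Implicit Types (q : Ht t) (u : (Ht t)^nat).

Lemma nbhs_HtP q (A : set (Ht t)) :
  nbhs q A <-> exists2 e : R, 0 < e & forall x, ht_norm (x - q) < e -> A x.
Proof.
split.
- case=> _ [[B Bop <-] /= Bq BA].
  have : nbhs (hval q : 'M[R[i]^o]_2) B by exact: open_nbhs_nbhs.
  case=> P Pq PB.
  have /choice [e he] : forall ij : 'I_2 * 'I_2, exists e : R, 0 < e /\
      forall z : R[i], normc (z - hval q ij.1 ij.2) < e -> P ij.1 ij.2 z.
    move=> [i j] /=; have /nbhs_ballP [[e e'] /= e0 eP] := Pq i j.
    (* Balls of [R[i]] have a radius in [R[i]]; positivity forces its imaginary part to be 0. *)
    move: e0; rewrite ltcE /= => /andP [/eqP e'0 e0]; subst e'.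
    exists e; split=> // z ze; apply: eP.
    by rewrite /ball /= distrC -[X in X < _]/((normc _)%:C)%C ltcR.
  exists (\big[Num.min/1]_ij e ij).
    apply: (big_ind (fun x : R => 0 < x)) => [|x y x0 y0|ij _].
    - exact: ltr01.
    - by rewrite lt_min x0.
    - exact: (he ij).1.
  move=> x xq; apply: BA; apply: PB => i j.
  apply: ((he (i, j)).2); apply: (@le_lt_trans _ _ (ht_norm (x - q))).
    by have := normc_le_ht_norm (x - q) i j; rewrite hvalB mxE [X in _ + X]mxE.
  by apply: (lt_le_trans xq); exact: (bigmin_le_cond _ (j := (i, j))).
- case=> e e0 eA.
  (* [ht_norm] adds four entries, hence the quarter. *)
  have e40 : 0 < e / 4 by rewrite divr_gt0.
  pose B : set 'M[R[i]^o]_2 := [set M | forall i j, ball (hval q i j : R[i]^o) ((e / 4)%:C)%C (M i j)].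
  have : nbhs (hval q : 'M[R[i]^o]_2) B.
    exists (fun i j => ball (hval q i j : R[i]^o) ((e / 4)%:C)%C) => // i j.
    by apply: nbhsx_ballx; rewrite ltcR.
  rewrite nbhsE => -[W [Wop Wq] WB].
  exists [set x : Ht t | W (hval x)]; split=> //; first by exists W.
  move=> x /WB Bx; apply: eA.
  have h i j : normc (hval (x - q) i j) < e / 4.
    rewrite hvalB mxE [X in _ + X]mxE; have := Bx i j.
    by rewrite /ball /= distrC -[X in X < _]/((normc _)%:C)%C ltcR.
  move: (h 0 0) (h 0 1) (h 1 0) (h 1 1); rewrite ht_normE => *; lra.
Qed.

Lemma cvgHtP u q :
  (u @ \oo --> q) <-> ((ht_norm (u n - q)) @[n --> \oo] --> (0 : R)).
Proof.
split=> [uq|].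
- apply/cvgr0_seqP => e e0.
  have qe : nbhs q [set x | ht_norm (x - q) < e] by apply/nbhs_HtP; exists e.
  have near_q : \forall n \near \oo, ht_norm (u n - q) < e := uq _ qe.
  by apply: filterS near_q => n qn; rewrite ger0_norm ?ht_norm_ge0.
- move=> h A /nbhs_HtP [e e0 eA].
  have near_q : \forall n \near \oo, `|ht_norm (u n - q)| < e by exact: (cvgr0_seqP _).1.
  apply: (@filterS _ \oo _ _ _ _ near_q) => n.
  by rewrite ger0_norm ?ht_norm_ge0 // => /eA.
Qed.

Lemma ht_norm_cvg_unique u p q :
  ht_norm (u n - p) @[n --> \oo] --> (0 : R) ->
  ht_norm (u n - q) @[n --> \oo] --> (0 : R) -> p = q.
Proof.
move=> up uq; apply/eqP; rewrite -subr_eq0; apply/eqP/ht_norm_eq0.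
have h : ht_norm (u n - p) + ht_norm (u n - q) @[n --> \oo] --> (0 : R).
  by rewrite -[X in _ --> X]addr0; apply: cvgD.
apply/eqP; rewrite eq_le ht_norm_ge0 andbT; apply: (cvgr_to_ge h).
apply: nearW => n; rewrite -(ht_normN (p - q)) opprB.
have -> : q - p = (u n - p) - (u n - q) by rewrite opprB [RHS]addrC subrKA.
by rewrite -[in leRHS](ht_normN (u n - q)) ht_normD.
Qed.

Lemma squeeze_cvgr0 (f h : R^nat) : (forall n, 0 <= f n <= h n) ->
  h @ \oo --> 0 -> f @ \oo --> 0.
Proof.
move=> fh h0; apply/cvgr0_seqP => e e0.
have near_h : \forall n \near \oo, `|h n| < e by exact: (cvgr0_seqP _).1.
apply: filterS near_h => n; have /andP [f0 fhn] := fh n.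
by rewrite !ger0_norm ?(le_trans f0 fhn) //; exact: le_lt_trans.
Qed.

(** The first column determines the matrix: the second one is, up to conjugation, the same two
    numbers with a factor [t]. Four real coordinates therefore control the norm. *)
Lemma ht_norm_le_re_im q : ht_norm q <= (2 + `|t|) *
  (`|complex.Re (hval q 0 0)| + `|complex.Im (hval q 0 0)| +
   (`|complex.Re (hval q 1 0)| + `|complex.Im (hval q 1 0)|)).
Proof.
rewrite ht_normE hvalE !hmxE !Normc.normcM.
have nb (z : R[i]) : normc z <= `|complex.Re z| + `|complex.Im z|.
  case: z => a b /=; rewrite -[leRHS]ger0_norm ?addr_ge0 // -sqrtr_sqr.
  rewrite ler_wsqrtr // sqrrD !real_normK ?num_real //.
  by rewrite lerD2r lerDl mulrn_wge0 // mulr_ge0.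
rewrite normc_real !normc_conj.
have aux (A B a b T : R) : 0 <= a -> 0 <= b -> 0 <= T -> a <= A -> b <= B ->
    a + T * b + (b + a) <= (2 + T) * (A + B) by move=> *; nra.
have nbB := nb (hb q)^*%C.
apply: aux; rewrite ?normc_ge0 ?nb //.
by move: nbB; rewrite !normc_conj.
Qed.

Lemma abs_cvg_series (c u : R^nat) : (forall n, `|u n| <= c n) ->
  cvgn (series c) -> cvgn (series u).
Proof.
move=> uc cc; apply: (@normed_cvg R R^o); apply: series_le_cvg cc => //= n.
exact: le_trans (uc n).
Qed.

(** Completeness: the four real coordinates of the first column converge absolutely, and their
    limits define an element of [Ht t]. *)
Lemma ht_norm_series_cvg u : cvgn (series (fun n => ht_norm (u n))) ->
  exists q, ht_norm (series u n - q) @[n --> \oo] --> (0 : R).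
Proof.
move=> cu.
pose comp (F : {additive R[i] -> R}) i := fun q : Ht t => F (hval q i 0).
have compc (F : {additive R[i] -> R}) i : (forall z, `|F z| <= normc z) ->
    exists l, (comp F i (series u n) - l) @[n --> \oo] --> (0 : R).
  move=> Fn; exists (limn (series (comp F i \o u))).
  have cF : cvgn (series (comp F i \o u)).
    apply: abs_cvg_series cu => n; rewrite (le_trans (Fn _)) //.
    exact: normc_le_ht_norm.
  have comp_series n : comp F i (series u n) = series (comp F i \o u) n.
    rewrite /series /=.
    elim/big_rec2 : _ => [|k x y _ <-]; first by rewrite /comp hval0 mxE raddf0.
    by rewrite /comp hvalD mxE raddfD.
  by under eq_cvg do rewrite comp_series; apply/subr_cvg0.
have nIm (z : R[i]) : `|complex.Im z| <= normc z.
  by case: z => a b; rewrite /= -sqrtr_sqr ler_wsqrtr // lerDr sqr_ge0.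
have [l1 h1] := compc (@complex.Re R) 0 (@normr_Re_le R).
have [l2 h2] := compc (@complex.Im R) 0 nIm.
have [l3 h3] := compc (@complex.Re R) 1 (@normr_Re_le R).
have [l4 h4] := compc (@complex.Im R) 1 nIm.
(* The entry in position (1, 0) of [hmx] is the conjugate of its second argument, whence the minus
   sign. *)
exists (HMat (hmx_in t (l1 +i* l2)%C (l3 -i* l4)%C)); set q := HMat _.
apply: (@squeeze_cvgr0 _ (fun n => (2 + `|t|) *
   (`|complex.Re (hval (series u n) 0 0) - l1| +
    `|complex.Im (hval (series u n) 0 0) - l2| +
   (`|complex.Re (hval (series u n) 1 0) - l3| +
    `|complex.Im (hval (series u n) 1 0) - l4|)))) => [n|].
  rewrite ht_norm_ge0 /= (le_trans (ht_norm_le_re_im _)) //.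
  rewrite hvalB [hval q]/(hmx _ _ _) !mxE /=.
  by move: (hval _ 0 0) (hval _ 1 0) => [a b] [c d] /=; rewrite opprK.
rewrite -[X in _ --> X](mulr0 (2 + `|t|)); apply: cvgMr.
by rewrite -[X in _ --> X]addr0; apply: cvgD; rewrite -[X in _ --> X]addr0;
  apply: cvgD; apply/norm_cvg0P.
Qed.

End Ht_topology.

(** * Geometric decay of powers from the operator norm *)

Section op_norm.
Context {R : realType} {t : R}.
Implicit Types (q : Ht t) (v : 'cV[R[i]]_2).

Lemma normc_le_vnorm v i : normc (v i 0) <= vnorm v.
Proof.
rewrite -[leLHS]ger0_norm ?normc_ge0 // -sqrtr_sqr ler_wsqrtr // (bigD1 i) //=.
by rewrite lerDl sumr_ge0 // => j _; rewrite sqr_ge0.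
Qed.

Lemma vnorm_le v : vnorm v <= normc (v 0 0) + normc (v 1 0).
Proof.
rewrite -[leRHS]ger0_norm ?addr_ge0 ?normc_ge0 // -sqrtr_sqr ler_wsqrtr //.
rewrite sum2E sqrrD -addrA lerD2l lerDr.
by rewrite mulrn_wge0 // mulr_ge0 // normc_ge0.
Qed.

Lemma vnormZ (c : R) v : 0 <= c -> vnorm (c%:C%C *: v) = c * vnorm v.
Proof.
move=> c0; rewrite /vnorm.
under eq_bigr => i _.
  rewrite mxE Normc.normcM exprMn.
  rewrite normc_real ger0_norm //.
  over.
by rewrite -mulr_sumr sqrtrM ?sqr_ge0 // sqrtr_sqr ger0_norm.
Qed.

Lemma vnorm_mulmx_le q v : vnorm v <= 1 -> vnorm (hval q *m v) <= norm_op q.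
Proof.
move=> v1; apply: ub_le_sup; last by exists v.
(* A bound for the set is required before its [sup] can serve as an upper bound. *)
exists (ht_norm q) => _ [w w1 <-]; rewrite (le_trans (vnorm_le _)) //.
rewrite ht_normE !mxE !sum2E; apply: lerD;
  rewrite (le_trans (le_normcD _ _)) // !Normc.normcM lerD //;
  by rewrite ler_piMr ?normc_ge0 // (le_trans (normc_le_vnorm _ _)).
Qed.

(** Iterating the operator bound on the basis vectors bounds each entry of [q ^+ n] by [r ^+ n]; the
    constant 4 counts the entries. *)
Lemma norm_op_geometric q : norm_op q < 1 ->
  exists2 r : R, 0 < r < 1 & forall n, ht_norm (q ^+ n) <= 4 * r ^+ n.
Proof.
move=> q1.
have q0 : 0 <= norm_op q.
  apply: (le_trans _ (vnorm_mulmx_le q (v := 0) _)).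
    by rewrite sqrtr_ge0.
  rewrite (le_trans (vnorm_le _)) // !mxE.
  by have -> : normc (0 : R[i]) = 0 by exact: Normc.normc0; rewrite addr0.
(* The midpoint stays positive even when [norm_op q] is 0, as the rescaling by [s] in [qr] demands
   of [r ^+ n]. *)
pose r := (1 + norm_op q) / 2.
have r0 : 0 < r by rewrite /r; lra.
exists r; first by rewrite r0 /r; lra.
have qr s v : 0 < s -> vnorm v <= s -> vnorm (hval q *m v) <= r * s.
  move=> s0 vs.
  have -> : v = s%:C%C *: ((s^-1)%:C%C *: v).
    by rewrite scalerA -rmorphM /= divff ?gt_eqF // scale1r.
  rewrite -scalemxAr (vnormZ _ (ltW s0)) [leLHS]mulrC ler_pM2r //.
  apply: (@le_trans _ _ (norm_op q)); last by rewrite /r; lra.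
  apply: vnorm_mulmx_le; rewrite vnormZ ?invr_ge0 ?(ltW s0) //.
  by rewrite ler_pdivrMl // mulr1.
have qnr n v : vnorm v <= 1 -> vnorm (hval (q ^+ n) *m v) <= r ^+ n.
  move=> v1; elim: n => [|n IH].
    by rewrite expr0 hval1 mul1mx.
  by rewrite exprS hvalM -mulmxA exprS qr // exprn_gt0.
move=> n.
have entry i j : normc (hval (q ^+ n) i j) <= r ^+ n.
  have := qnr n (delta_mx j 0); rewrite -colE => h.
  have := normc_le_vnorm (col j (hval (q ^+ n))) i; rewrite mxE => e.
  apply: (le_trans e); apply: h.
  rewrite (le_trans (vnorm_le _)) // !mxE.
  by rewrite !normc_bool; case: (ord2P j) => ->; rewrite /= ?add0r ?addr0.
rewrite ht_normE.
by move: (entry 0 0) (entry 0 1) (entry 1 0) (entry 1 1) => *; lra.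
Qed.

End op_norm.

(** * Linear recurrences and geometric sums *)

Section recurrence.
Context {R : realType} {t : R}.

Lemma contraction_cvg0 (r : R) (s w : R^nat) : 0 < r < 1 ->
  (forall n, 0 <= s n) -> (forall n, s n.+1 <= r * s n + w n) ->
  w @ \oo --> 0 -> s @ \oo --> 0.
Proof.
move=> /andP [r0 r1] s0 sS w0; apply/cvgr0_seqP => e e0.
(* With this [d], the map sending [s] to [r * s + d] has fixed point [e / 2]. *)
pose d := e / 2 * (1 - r).
have d0 : 0 < d by rewrite mulr_gt0 ?divr_gt0 ?subr_gt0.
have [M _ wM] := (cvgr0_seqP w).1 w0 d d0.
have sM m : s (M + m)%N <= r ^+ m * s M + e / 2.
  elim: m => [|m IH]; first by rewrite addn0 expr0 mul1r lerDl divr_ge0 // ltW.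
  rewrite addnS (le_trans (sS _)) //.
  have := wM (M + m)%N (leq_addr _ _); rewrite ltr_norml => /andP [_ wd].
  have : r * s (M + m)%N <= r * (r ^+ m * s M + e / 2) by rewrite ler_pM2l.
  by rewrite exprS /d in wd *; lra.
have rM : (fun m => r ^+ m * s M) @ \oo --> (0 : R).
  rewrite -(mul0r (s M)); apply: cvgMl; apply: cvg_expr.
  by rewrite ger0_norm // ltW.
have [K _ rK] := (cvgr0_seqP _).1 rM (e / 2) (divr_gt0 e0 (ltr0n _ 2)).
exists (M + K)%N => // n /= MKn; rewrite ger0_norm //.
have Mn : (M <= n)%N by rewrite (leq_trans (leq_addr K _)).
rewrite -(subnKC Mn) (le_lt_trans (sM _)) //.
have := rK (n - M)%N; rewrite /= leq_subRL // => /(_ MKn).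
by rewrite ger0_norm ?mulr_ge0 ?exprn_ge0 ?(ltW r0) // => ?; lra.
Qed.

(** One step need not contract [ht_norm], since only the powers of [a] decay. The induction
    therefore bounds [a ^+ m * u n] for all [m] at once, against a scalar majorant [s] that does
    contract. *)
Lemma recurrence_cvg0 (r : R) (a : Ht t) (u w : (Ht t)^nat) : 0 < r < 1 ->
  (forall n, ht_norm (a ^+ n) <= 4 * r ^+ n) ->
  u 0%N = 0 -> (forall n, u n.+1 = a * u n + w n) ->
  ht_norm (w n) @[n --> \oo] --> (0 : R) ->
  ht_norm (u n) @[n --> \oo] --> (0 : R).
Proof.
move=> r01 ar u0 uS w0; have /andP [r0 r1] := r01.
pose s := fix s n : R := if n is m.+1 then r * s m + ht_norm (w m) else 0.
have s0 n : 0 <= s n.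
  by elim: n => //= n IH; rewrite addr_ge0 ?ht_norm_ge0 // mulr_ge0 // ltW.
have us n m : ht_norm (a ^+ m * u n) <= 4 * r ^+ m * s n.
  elim: n m => [|n IH] m; first by rewrite u0 mulr0 ht_norm0 /= mulr0.
  rewrite uS mulrDr mulrA -exprSr (le_trans (ht_normD _ _)) //=.
  have := le_trans (ht_normM _ _) (ler_wpM2r (ht_norm_ge0 (w n)) (ar m)).
  by move: (IH m.+1); rewrite [r ^+ _]exprS => *; lra.
have s_cvg : s @ \oo --> 0 by apply: (contraction_cvg0 r01 s0 _ w0).
apply: (@squeeze_cvgr0 _ _ (fun n => 4 * s n)) => [n|].
  by rewrite ht_norm_ge0; have := us n 0%N; rewrite expr0 mul1r mulr1.
by rewrite -[X in _ --> X](mulr0 4); apply: cvgMr.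
Qed.

Lemma geometric_cvg0 (r : R) (a : Ht t) : 0 < r < 1 ->
  (forall n, ht_norm (a ^+ n) <= 4 * r ^+ n) ->
  ht_norm (a ^+ n) @[n --> \oo] --> (0 : R).
Proof.
move=> /andP [r0 r1] ar; apply: (@squeeze_cvgr0 _ _ (geometric 4 r)) => [n|].
  by rewrite ht_norm_ge0 ar.
by apply: cvg_geometric; rewrite ger0_norm // ltW.
Qed.

(** The powers of [b] are only assumed bounded, so that [b = 1] (Neumann series) is covered along
    with the entries of [gram]. *)
Lemma geometric_sum_cvg (r : R) (a b : Ht t) : 0 < r < 1 ->
  (forall n, ht_norm (a ^+ n) <= 4 * r ^+ n) ->
  (forall n, ht_norm (b ^+ n) <= 4) ->
  exists q, ht_norm (series (fun n => a ^+ n * b ^+ n) n - q) @[n --> \oo] --> (0 : R).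
Proof.
move=> /andP [r0 r1] ar br; apply: ht_norm_series_cvg.
apply: (@series_le_cvg _ _ (geometric 16 r)) => [n|n|n|].
- exact: ht_norm_ge0.
- by rewrite /= mulr_ge0 // exprn_ge0 // ltW.
- rewrite (le_trans (ht_normM _ _)) //.
  rewrite (le_trans (ler_pM (ht_norm_ge0 _) (ht_norm_ge0 _) (ar n) (br n))) //=.
  by lra.
- by apply: is_cvg_geometric_series; rewrite ger0_norm // ltW.
Qed.

End recurrence.

(** * The Stein equation and the Gram matrix *)

Section stein.
Context {R : realType} {t : R}.
Implicit Types (a b p q : Ht t) (u : (Ht t)^nat).

Lemma ht_norm_cvg_mul u a b q :
  ht_norm (u n - q) @[n --> \oo] --> (0 : R) ->
  ht_norm (a * u n * b - a * q * b) @[n --> \oo] --> (0 : R).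
Proof.
move=> uq; apply: (@squeeze_cvgr0 _ _
  (fun n => ht_norm a * ht_norm (u n - q) * ht_norm b)) => [n|].
  rewrite ht_norm_ge0 -mulrBl -mulrBr (le_trans (ht_normM _ _)) //.
  by rewrite ler_wpM2r ?ht_norm_ge0 // ht_normM.
rewrite -[X in _ --> X](mul0r (ht_norm b)) -[X in X * _](mulr0 (ht_norm a)).
by apply: cvgMl; apply: cvgMr.
Qed.

(** The partial sums satisfy [S n.+1 = 1 + a * S n * b]; both sides pass to the limit. *)
Lemma stein_equation a b q :
  ht_norm (series (fun n => a ^+ n * b ^+ n) n - q) @[n --> \oo] --> (0 : R) ->
  q = 1 + a * q * b.
Proof.
move=> Sq; pose S := series (fun n => a ^+ n * b ^+ n).
have SS n : S n.+1 = 1 + a * S n * b.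
  rewrite /S /series /= big_nat_recl // !expr0 mulr1 mulr_sumr mulr_suml.
  by congr (_ + _); apply: eq_bigr => i _; rewrite exprS exprSr !mulrA.
apply: (@ht_norm_cvg_unique _ _ (fun n => S n.+1)).
  by rewrite (cvg_shiftS (fun n => ht_norm (S n - q))).
under eq_cvg => n do rewrite SS opprD addrACA subrr add0r.
exact: ht_norm_cvg_mul.
Qed.

Lemma ht_norm1 : ht_norm (1 : Ht t) = 2.
Proof.
rewrite ht_normE hval1 !mxE.
by rewrite !normc_bool /= addr0 add0r.
Qed.

Lemma unit_one_sub (r : R) a : 0 < r < 1 ->
  (forall n, ht_norm (a ^+ n) <= 4 * r ^+ n) -> 1 - a \is a GRing.unit.
Proof.
move=> r01 ar.
have b1 n : ht_norm ((1 : Ht t) ^+ n) <= 4 by rewrite expr1n ht_norm1 ler_nat.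
have [q Sq] := geometric_sum_cvg r01 ar b1.
(* The Stein equation with [b = 1] gives only a right inverse of [1 - a]; commutation, inherited
   from the partial sums, makes it two-sided. *)
have aq : a * q = q * a.
  apply: (@ht_norm_cvg_unique _ _
    (fun n => a * series (fun n => a ^+ n * 1 ^+ n) n)).
    under eq_cvg => n do rewrite -[a * _]mulr1 -[a * q]mulr1.
    exact: ht_norm_cvg_mul.
  have comm_series n : a * series (fun n => a ^+ n * 1 ^+ n) n =
      1 * series (fun n => a ^+ n * 1 ^+ n) n * a.
    rewrite /series /= mul1r mulr_sumr mulr_suml; apply: eq_bigr => i _.
    by rewrite expr1n mulr1 -exprS -exprSr.
  under eq_cvg => n do rewrite comm_series -[q * a]mul1r mulrA.
  exact: ht_norm_cvg_mul.
have := stein_equation Sq; rewrite mulr1 => qE.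
apply/unitrP; exists q; split.
  by rewrite mulrBr mulr1 -aq {1}qE addrK.
by rewrite mulrBl mul1r {1}qE addrK.
Qed.

Variables (N : nat) (alpha : 'I_N -> Ht t).
Hypothesis alpha_lt1 : forall j, norm_op (alpha j) < 1.

(** Shows that the [limn] in the definition of [gram] is a genuine limit. *)
Lemma gram_cvg j k :
  ht_norm (series (fun n => alpha j ^+ n * hadj (alpha k) ^+ n) n -
    gram alpha j k) @[n --> \oo] --> (0 : R).
Proof.
have [r r01 jr] := norm_op_geometric (alpha_lt1 j).
have [s /andP [s0 s1] ks] := norm_op_geometric (alpha_lt1 k).
have k4 n : ht_norm (hadj (alpha k) ^+ n) <= 4.
  by rewrite -hadjX ht_norm_hadj (le_trans (ks n)) // ler_piMr // exprn_ile1 // ltW.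
have [q Sq] := geometric_sum_cvg r01 jr k4.
rewrite mxE; apply/cvgHtP.
by apply: (cvgP q); apply/cvgHtP.
Qed.

Lemma gram_stein j k :
  gram alpha j k = 1 + alpha j * gram alpha j k * hadj (alpha k).
Proof. exact: stein_equation (gram_cvg j k). Qed.

(** The involution preserves [ht_norm] and exchanges the partial sums for [(j, k)] and [(k, j)]. *)
Lemma gram_hermitian j k : hadj (gram alpha j k) = gram alpha k j.
Proof.
apply: (ht_norm_cvg_unique _ (gram_cvg k j)).
have series_hadj n : series (fun n => alpha k ^+ n * hadj (alpha j) ^+ n) n =
    hadj (series (fun n => alpha j ^+ n * hadj (alpha k) ^+ n) n).
  rewrite /series /= raddf_sum; apply: eq_bigr => i _.
  by rewrite /= hadjM !hadjX hadjK.
under eq_cvg => n do rewrite series_hadj -raddfB ht_norm_hadj.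
exact: gram_cvg.
Qed.

End stein.

(** * Pure algebra of the linear system, over a ring with involution *)

Section realization.
Variables (A : nzRingType) (star : {additive A -> A}).
Hypothesis star1 : star 1 = 1.
Hypothesis starM : forall x y, star (x * y) = star y * star x.
Hypothesis starK : involutive star.
Variables (N : nat) (a b : 'I_N -> A) (G : 'M[A]_N).
Variables (f g : nat -> A) (z : nat -> 'I_N -> A).
Hypothesis stein : forall j k, G j k = 1 + a j * G j k * star (a k).
Hypothesis hermitian : forall j k, star (G j k) = G k j.
Hypothesis Gb : forall j, (1 - a j) * (\sum_k G j k * b k) = 1.
Hypothesis z0 : forall j, z 0%N j = 0.
Hypothesis zS : forall n j, z n.+1 j = star (a j) * z n j + b j * g n.
Hypothesis fE : forall n, f n = g n + \sum_j (z n j - z n.+1 j).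

(** The factor is chosen so that [z n j - z n.+1 j = x n j - b j * g n], which makes the output a
    function of the current state and input. *)
Definition state n j : A := (1 - star (a j)) * z n j.
Definition costate n j : A := \sum_k G j k * state n k.
Local Notation x := state.
Local Notation P := costate.

Lemma state0 j : x 0 j = 0. Proof. by rewrite /state z0 mulr0. Qed.

Lemma stateS n j : x n.+1 j = star (a j) * x n j + (1 - star (a j)) * b j * g n.
Proof.
rewrite /state zS mulrDr !mulrA; congr (_ * _ + _).
by rewrite mulrBl mulrBr mul1r mulr1.
Qed.

Lemma output_state n : f n = g n + \sum_j x n j - (\sum_j b j) * g n.
Proof.
rewrite fE -addrA mulr_suml -sumrB; congr (_ + _); apply: eq_bigr => j _.
by rewrite zS /state mulrBl mul1r opprD addrA.
Qed.

(** [stein] replaces [a j * G j k * star (a k)] by [G j k - 1], and [Gb] replaces [a j] times the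
    sum of the [G j k * b k] by that sum minus 1. What is left besides [P n j] is the opposite of
    the output in [output_state]. *)
Lemma output_costate n j : a j * P n.+1 j = P n j - f n.
Proof.
have aG k : a j * G j k * star (a k) = G j k - 1.
  by rewrite {2}stein addrC addKr.
have -> : a j * P n.+1 j =
    \sum_k ((G j k - 1) * x n k + (a j * (G j k * b k) - (G j k - 1) * b k) * g n).
  rewrite /costate mulr_sumr; apply: eq_bigr => k _.
  rewrite stateS mulrDr mulrDr !mulrA aG; congr (_ + _ * _).
  by rewrite mulrBr mulr1 mulrBl aG.
rewrite big_split /= -mulr_suml sumrB -mulr_sumr.
have -> : \sum_k (G j k - 1) * x n k = P n j - \sum_k x n k.
  by rewrite -sumrB; apply: eq_bigr => k _; rewrite mulrBl mul1r.
have -> : \sum_k (G j k - 1) * b k = \sum_k G j k * b k - \sum_k b k.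
  by rewrite -sumrB; apply: eq_bigr => k _; rewrite mulrBl mul1r.
have aGb : a j * (\sum_k G j k * b k) = \sum_k G j k * b k - 1.
  by have := Gb j; rewrite mulrBl mul1r => <-; rewrite subKr.
rewrite aGb opprB [_ - 1 + _]addrC subrKA mulrBl mul1r output_state.
rewrite !opprD opprK -!addrA; congr (_ + _).
by rewrite [LHS]addrA [RHS]addrC.
Qed.

Lemma telescoping_value n j :
  \sum_(0 <= k < n) a j ^+ k * f k = - (a j ^+ n * P n j).
Proof.
elim: n => [|n IH].
  by rewrite big_geq // /costate big1 ?mulr0 ?oppr0 // => k _; rewrite state0 mulr0.
rewrite big_nat_recr //= IH exprSr -mulrA output_costate mulrBr opprB.
by rewrite addrC.
Qed.

(** Applying [star] to [Gb k], with [G] hermitian, shows that the row of sums of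
    [star (b j) * G j k] is a left inverse of [1 - star (a k)]; it cancels the factor in [state]. *)
Lemma sum_star_costate n : \sum_j star (b j) * P n j = \sum_k z n k.
Proof.
rewrite /costate; under eq_bigr do rewrite mulr_sumr.
rewrite exchange_big; apply: eq_bigr => k _ /=.
under eq_bigr do rewrite /state !mulrA.
rewrite -!mulr_suml.
have := congr1 (star) (Gb k); rewrite starM star1 raddf_sum raddfB /= star1.
under eq_bigr do rewrite starM hermitian.
by move=> ->; rewrite mul1r.
Qed.

Lemma energy_balance n :
  \sum_j star (x n.+1 j) * P n.+1 j + star (f n) * f n =
  \sum_j star (x n j) * P n j + star (g n) * g n.
Proof.
(* Only the left factor is expanded by [stateS]; each [a j] it produces is absorbed by
   [output_costate]. *)
have -> : \sum_j star (x n.+1 j) * P n.+1 j =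
    \sum_j star (x n j) * (P n j - f n) +
    star (g n) * (\sum_j star (b j) * (P n.+1 j - (P n j - f n))).
  rewrite mulr_sumr -big_split; apply: eq_bigr => j _ /=.
  rewrite stateS raddfD /= !starM starK raddfB /= star1 starK mulrDl.
  rewrite -[_ * a j * _]mulrA output_costate; congr (_ + _).
  by rewrite -!mulrA [(1 - _) * _]mulrBl mul1r output_costate.
have -> : \sum_j star (b j) * (P n.+1 j - (P n j - f n)) =
    \sum_k z n.+1 k - \sum_k z n k + star (\sum_j b j) * f n.
  rewrite -!sum_star_costate -sumrB raddf_sum mulr_suml -big_split; apply: eq_bigr => j _ /=.
  by rewrite opprB addrA addrAC mulrDr mulrBr.
have -> : \sum_j star (x n j) * (P n j - f n) =
    \sum_j star (x n j) * P n j - star (\sum_j x n j) * f n.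
  rewrite raddf_sum mulr_suml -sumrB; apply: eq_bigr => j _.
  by rewrite mulrBr.
have -> : \sum_k z n.+1 k - \sum_k z n k = g n - f n.
  by rewrite fE sumrB opprD addNKr opprB.
(* Expanding only the left factor produces exactly the cross terms that cancel those of the energy
   increment. *)
have fstar : star (f n) * f n = star (g n) * f n +
    star (\sum_j x n j) * f n - star (g n) * (star (\sum_j b j) * f n).
  by rewrite {1}output_state raddfB raddfD /= starM mulrBl mulrDl mulrA.
rewrite fstar mulrDr mulrBr; set v := star (g n) * f n.
set w := star _ * f n; set y := star (g n) * (_ * _).
rewrite -[in RHS](addrNK w (\sum_j _)) -!addrA; congr (_ + (_ + _)).
rewrite [RHS]addrC; congr (_ + _).
by rewrite addrCA addKr addrC subrK.
Qed.

End realization.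

(** * Coefficients of star-products with a geometric series *)

Section star_product.
Variable A : nzRingType.
Implicit Types (c : A) (h : pser A).

Lemma pcoef_sum (I : Type) (s : seq I) (P : pred I) (F : I -> pser A) n :
  (\sum_(i <- s | P i) F i) n = \sum_(i <- s | P i) F i n.
Proof. by elim/big_rec2 : _ => // i x y _ <-. Qed.

Lemma pgeom_mulE c h n :
  ((1 - pX A * pC c)^-1 * h) n = \sum_(k < n.+1) c ^+ (n - k) * h k.
Proof. by rewrite pgeom. Qed.

(** Multiplication by the inverse of [1 - pX A * pC c] solves a first-order recurrence, which is the
    source of the state equation. *)
Lemma pgeom_mulS c h n :
  ((1 - pX A * pC c)^-1 * h) n.+1 =
  c * ((1 - pX A * pC c)^-1 * h) n + h n.+1.
Proof.
rewrite !pgeom_mulE big_ord_recr /= subnn mul1r mulr_sumr; congr (_ + _).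
by apply: eq_bigr => k _; rewrite subSn -1?ltnS // exprS mulrA.
Qed.

Lemma pgeom_mul0 c h : ((1 - pX A * pC c)^-1 * h) 0%N = h 0%N.
Proof. by rewrite pgeom_mulE big_ord1 mul1r. Qed.

End star_product.

(** * Convergence facts for elements of [H2] *)

Section H2_bounds.
Context {R : realType} {t : R}.
Hypothesis t0 : t != 0.
Implicit Types (q : Ht t) (g : pser (Ht t)).

Lemma ht_norm_le_norm_E : exists K : R, forall q,
  ht_norm q ^+ 2 <= K * norm_E q ^+ 2.
Proof.
have T0 : 0 < `|t| by rewrite normr_gt0.
(* The square of [2 * A + (1 + T) * B] is at most [8 * A ^+ 2 + 2 * (1 + T) ^+ 2 * B ^+ 2]; the
   division by [T] compensates the weight of [B ^+ 2] in [norm_E]. *)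
exists (8 + 2 * (1 + `|t|) ^+ 2 / `|t|) => q.
rewrite /norm_E sqr_sqrtr; last first.
  apply: addr_ge0; first exact: sqr_ge0.
  by apply: mulr_ge0; [exact: ltW|exact: sqr_ge0].
have -> : ht_norm q = 2 * normc (ha q) + (1 + `|t|) * normc (hb q).
  rewrite ht_normE hvalE !hmxE Normc.normcM normc_real.
  rewrite (normc_conj (ha q)) (normc_conj (hb q)).
  by ring.
move: (normc (ha q)) (normc (hb q)) `|t| T0 => A B T T0.
have -> : (8 + 2 * (1 + T) ^+ 2 / T) * (A ^+ 2 + T * B ^+ 2) =
    (8 * A ^+ 2 + 2 * (1 + T) ^+ 2 * B ^+ 2) +
    (8 * T * B ^+ 2 + 2 * (1 + T) ^+ 2 / T * A ^+ 2).
  by field; rewrite gt_eqF.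
have : 0 <= 8 * T * B ^+ 2 + 2 * (1 + T) ^+ 2 / T * A ^+ 2.
  apply: addr_ge0; apply: mulr_ge0; rewrite ?sqr_ge0 //; first by lra.
  by apply: divr_ge0 (ltW T0); apply: mulr_ge0 => //; exact: sqr_ge0.
have : 0 <= (2 * A - (1 + T) * B) ^+ 2 by rewrite sqr_ge0.
by move=> *; lra.
Qed.

Lemma H2_series_ht_norm g : H2 g -> cvgn (series (fun n => ht_norm (g n) ^+ 2)).
Proof.
have [K gK] := ht_norm_le_norm_E => cg.
apply: (@series_le_cvg _ _ (fun n => K * norm_E (g n) ^+ 2)) => // [n|n|].
- by rewrite sqr_ge0.
- by rewrite (le_trans _ (gK _)) ?sqr_ge0.
- exact: (is_cvg_seriesZ (k := K) cg).
Qed.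

Lemma H2_coef_cvg0 g : H2 g -> ht_norm (g n) @[n --> \oo] --> (0 : R).
Proof.
move=> /H2_series_ht_norm /cvg_series_cvg_0 g0; apply/cvgr0_seqP => e e0.
have near_g := (cvgr0_seqP _).1 g0 (e ^+ 2) (exprn_gt0 2 e0).
apply: filterS near_g => n.
rewrite ger0_norm ?sqr_ge0 // ger0_norm ?ht_norm_ge0 //.
by rewrite ltr_pXn2r // nnegrE ?ht_norm_ge0 // ltW.
Qed.

Lemma H2_form_cvg g : H2 g -> cvgn (series (fun n => htr (hadj (g n) * g n))).
Proof.
move=> /H2_series_ht_norm; apply: abs_cvg_series => n.
rewrite (le_trans (htr_le_ht_norm _)) // (le_trans (ht_normM _ _)) //.
by rewrite ht_norm_hadj expr2.
Qed.

End H2_bounds.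

(** * Sums and products of null sequences *)

Section cvg0_closure.
Context {R : realType} {t : R}.
Implicit Types (u v : (Ht t)^nat).

Lemma ht_norm_cvg0_sum (N : nat) (F : nat -> 'I_N -> Ht t) :
  (forall k, ht_norm (F n k) @[n --> \oo] --> (0 : R)) ->
  ht_norm (\sum_k F n k) @[n --> \oo] --> (0 : R).
Proof.
move=> F0; apply: (@squeeze_cvgr0 _ _ (fun n => \sum_k ht_norm (F n k))) => [n|].
  by rewrite ht_norm_ge0 ht_norm_sum.
elim: (index_enum _) => [|k s IH].
  by under eq_cvg do rewrite big_nil; exact: cvg_cst.
under eq_cvg do rewrite big_cons.
by have := cvgD (F0 k) IH; rewrite addr0; exact.
Qed.

Lemma ht_norm_cvg0_mull u (p : Ht t) :
  ht_norm (u n) @[n --> \oo] --> (0 : R) ->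
  ht_norm (p * u n) @[n --> \oo] --> (0 : R).
Proof.
move=> u0; apply: (@squeeze_cvgr0 _ _ (fun n => ht_norm p * ht_norm (u n))) => [n|].
  by rewrite ht_norm_ge0 ht_normM.
by rewrite -[X in _ --> X](mulr0 (ht_norm p)); apply: cvgMr.
Qed.

Lemma ht_norm_cvg0M u v :
  ht_norm (u n) @[n --> \oo] --> (0 : R) ->
  ht_norm (v n) @[n --> \oo] --> (0 : R) ->
  ht_norm (u n * v n) @[n --> \oo] --> (0 : R).
Proof.
move=> u0 v0; apply: (@squeeze_cvgr0 _ _ (fun n => ht_norm (u n) * ht_norm (v n))).
  by move=> n; rewrite ht_norm_ge0 ht_normM.
by rewrite -[X in _ --> X](mulr0 0); apply: cvgM.
Qed.

End cvg0_closure.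

(** * Multiplication by [Theta] as a linear system *)

Section Theta_realization.
Context {R : realType} {t : R}.
Variables (N : nat) (alpha : 'I_N -> Ht t) (Ginv : 'M[Ht t]_N).

Definition Theta_vec j : Ht t := \sum_k Ginv j k * (1 - alpha k)^-1.

(** The leading [pX] is a one-step delay: the state at [n] depends on the inputs before [n] and
    starts at 0. *)
Definition Theta_state (g : pser (Ht t)) n j : Ht t :=
  (pX (Ht t) * ((1 - pX (Ht t) * pC (hadj (alpha j)))^-1 *
    (pC (Theta_vec j) * g))) n.

Lemma Theta_state0 g j : Theta_state g 0 j = 0.
Proof. by rewrite /Theta_state pXstar. Qed.

Lemma Theta_stateS g n j :
  Theta_state g n.+1 j =
  hadj (alpha j) * Theta_state g n j + Theta_vec j * g n.
Proof.
rewrite /Theta_state !pXstar.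
case: n => [|n]; first by rewrite pgeom_mul0 mulr0 add0r; exact: pCstar.
by rewrite pgeom_mulS; congr (_ + _); exact: pCstar.
Qed.

(** By the delay in [Theta_state], coefficient [n] of the undelayed series is the state at [n.+1],
    so the factor [1 - pX] of [Theta] yields the difference of consecutive states. *)
Lemma Theta_output g n :
  (Theta alpha Ginv * g) n =
  g n + \sum_j (Theta_state g n j - Theta_state g n.+1 j).
Proof.
pose F j := (1 - pX (Ht t) * pC (hadj (alpha j)))^-1.
have -> : Theta alpha Ginv =
    1 - (1 - pX (Ht t)) * \sum_j F j * pC (Theta_vec j).
  rewrite /Theta; congr (_ - _ * _); apply: pserP => n0.
  have starC (h : pser (Ht t)) c : (h * pC c) n0 = h n0 * c by exact: pstarC.
  rewrite mxE !pcoef_sum.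
  transitivity (\sum_k \sum_j F j n0 * (Ginv j k * (1 - alpha k)^-1)).
    apply: eq_bigr => k _; rewrite !mxE starC pcoef_sum mulr_suml.
    by apply: eq_bigr => j _; rewrite !mxE starC mulrA.
  rewrite exchange_big; apply: eq_bigr => j _.
  by rewrite starC -mulr_sumr.
rewrite mulrBl mul1r -mulrA psubE; congr (_ + _).
rewrite mulrBl mul1r psubE opprB mulr_suml mulr_sumr !pcoef_sum -sumrB.
apply: eq_bigr => j _; rewrite /Theta_state -mulrA; congr (_ - _).
by rewrite pXstar.
Qed.

End Theta_realization.

Theorem theorem4p13 (R : realType) (t : R) (N : nat) (alpha : 'I_N -> Ht t)
    (Ginv : 'M[Ht t]_N) :
  t != 0 ->
  (forall j : 'I_N, norm_op (alpha j) < 1) ->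
  gram alpha *m Ginv = 1%:M ->
  Ginv *m gram alpha = 1%:M ->
  forall f g : pser (Ht t), H2 f -> H2 g ->
    f = Theta alpha Ginv * g ->
    (forall j : 'I_N, vanishes_at f (alpha j)) /\ hform f f = hform g g.
Proof.
move=> t0 alpha1 GGinv _ f g _ Hg fE.
pose b := Theta_vec alpha Ginv; pose z := Theta_state alpha Ginv g.
pose c j := hadj (alpha j).
have Gb j : (1 - alpha j) * (\sum_k gram alpha j k * b k) = 1.
  have -> : \sum_k gram alpha j k * b k =
      \sum_l (gram alpha *m Ginv) j l * (1 - alpha l)^-1.
    under eq_bigr do rewrite mulr_sumr.
    rewrite exchange_big; apply: eq_bigr => l _.
    rewrite [in RHS]mxE mulr_suml; apply: eq_bigr => k _.
    by rewrite mulrA.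
  rewrite GGinv (bigD1 j) //= big1 ?addr0 => [|l lj].
    (* The inverse of a non-unit is a default value, so [1 - alpha j] has to be shown invertible. *)
    rewrite mxE eqxx mul1r divrr //.
    have [r r01 jr] := norm_op_geometric (alpha1 j).
    exact: unit_one_sub r01 jr.
  by rewrite mxE eq_sym (negbTE lj) mul0r.
have z0 j : z 0%N j = 0 by exact: Theta_state0.
have zS n j : z n.+1 j = c j * z n j + b j * g n by exact: Theta_stateS.
have fz n : f n = g n + \sum_j (z n j - z n.+1 j).
  by rewrite fE; exact: Theta_output.
pose x n j := (1 - c j) * z n j.
pose P n j := \sum_k gram alpha j k * x n k.
(* The powers of [c j] inherit their decay from [alpha j] because [hadj] preserves [ht_norm], and
   the forcing term vanishes at infinity since [g] is in [H2]. *)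
have x_cvg0 j : ht_norm (x n j) @[n --> \oo] --> (0 : R).
  have [r r01 jr] := norm_op_geometric (alpha1 j).
  apply: (@recurrence_cvg0 _ _ r (c j) _ (fun n => (1 - c j) * b j * g n)) => //.
  - by move=> n; rewrite -hadjX ht_norm_hadj.
  - exact: state0 z0 j.
  - by move=> n; exact: (stateS (star := @hadj R t) zS).
  - by apply: ht_norm_cvg0_mull; exact: H2_coef_cvg0.
have P_cvg0 j : ht_norm (P n j) @[n --> \oo] --> (0 : R).
  by apply: ht_norm_cvg0_sum => k; exact: ht_norm_cvg0_mull.
split=> [j|].
  apply/cvgHtP.
  have partial_sum n : series (fun n => alpha j ^+ n * f n) n =
      - (alpha j ^+ n * P n j).
    exact: (telescoping_value (star := @hadj R t) (gram_stein alpha1) Gb z0 zS fz).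
  under eq_cvg do rewrite subr0 partial_sum ht_normN.
  have [r r01 jr] := norm_op_geometric (alpha1 j).
  exact: ht_norm_cvg0M (geometric_cvg0 r01 jr) (P_cvg0 j).
pose E n := \sum_j hadj (x n j) * P n j.
have E_cvg0 : ht_norm (E n) @[n --> \oo] --> (0 : R).
  apply: ht_norm_cvg0_sum => k; apply: ht_norm_cvg0M (P_cvg0 k).
  by under eq_cvg do rewrite ht_norm_hadj; exact: x_cvg0.
have balance n : E n.+1 + hadj (f n) * f n = E n + hadj (g n) * g n.
  exact: (energy_balance (star := @hadj R t) hadj1 hadjM hadjK
    (gram_stein alpha1) (gram_hermitian alpha1) Gb zS fz).
(* Sum of the traced energy balances from the zero initial state. *)
have series_form n : series (fun n => htr (hadj (f n) * f n)) n =
    series (fun n => htr (hadj (g n) * g n)) n - htr (E n).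
  elim: n => [|n IH].
    rewrite /series /= !big_geq // /E big1 => [|k _]; first by rewrite htr0 subr0.
    by rewrite /x z0 mulr0 hadj0 mul0r.
  rewrite !seriesSr IH; have := congr1 (@htr R t) (balance n).
  by rewrite !htrD => ?; lra.
(* The partial sums for [f] differ from those for [g] by [htr (E n)], which tends to 0, so they
   share the limit. *)
apply/cvg_lim => //.
have htrE0 : htr (E n) @[n --> \oo] --> (0 : R).
  apply/norm_cvg0P; apply: squeeze_cvgr0 E_cvg0 => n.
  by rewrite normr_ge0 htr_le_ht_norm.
under eq_cvg do rewrite series_form.
by have := cvgB (H2_form_cvg t0 Hg) htrE0; rewrite subr0; exact.
Qed.
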